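(* Let $\Delta$ be a finite abstract simplicial complex of dimension $d\ge1$, with $f^\Delta_d$ its number of $d$-simplices, and let $\rho^{(k)}_\infty$ and $\rho^{(k)}_0$ be zeros of maximal and minimal modulus, respectively, of the $h$-polynomial $h^{\Delta^{(k)}}(z)$ of the $k$-fold barycentric subdivision $\Delta^{(k)}$. Then as $k\to\infty$, $$\rho^{(k)}_\infty\sim -H_{1,d}\,f^\Delta_d\,(d+1)!^k,$$ and $$|\widetilde\chi(\Delta)|=H_{1,d}\,f^\Delta_d\,\bigl|\rho^{(k)}_0\bigr|\,(d+1)!^k\,(1+o(1)),$$ i.e. $|\widetilde\chi(\Delta)|\sim H_{1,d}f^\Delta_d|\rho^{(k)}_0|(d+1)!^k$.
   Context: An abstract simplicial complex $\Delta$ on a finite set is a family of subsets closed under taking subsets (the empty set included); a $d$-simplex is a member of cardinality $d+1$, and $\dim\Delta$ is the largest such $d$. Let $f^\Delta_i$ be the number of $i$-simplices ($f^\Delta_{-1}=1$). The reduced Euler characteristic is $\widetilde\chi(\Delta)=\sum_{\sigma\in\Delta}(-1)^{\#\sigma-1}$. The $h$-polynomial of $\Delta$ (of dimension $d$) is $h^\Delta(z)=\sum_{i=-1}^{d}f^\Delta_i(z-1)^{d-i}$. The barycentric subdivision $\Delta'$ of $\Delta$ is the complex consisting of $\emptyset$ together with all sets $\{\sigma_0,\dots,\sigma_n\}$ ($n\ge0$) of nonempty simplices of $\Delta$ with $\sigma_0\subsetneq\cdots\subsetneq\sigma_n$; $\Delta^{(0)}=\Delta$, $\Delta^{(k+1)}=(\Delta^{(k)})'$.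 $f(k)\sim g(k)$ means $f(k)/g(k)\to1$. For integers $i,d\ge -1$ define $f_{-1,-1}=1$, $f_{-1,d}=0$ for $d\ge0$, $f_{i,-1}=0$ for $i\ge0$, and $f_{i,d}=(i+1)!\,S(d+1,i+1)$ for $i,d\ge0$ ($S$ = Stirling numbers of the second kind). For $d\ge0$ define $F_{d,d}=1$ and recursively for $-1\le i\le d-1$, $F_{i,d}=\frac{1}{(d+1)!-(i+1)!}\sum_{j=i+1}^{d}f_{i,j}F_{j,d}$. Let $F_d(z)=\sum_{i=-1}^dF_{i,d}z^{d-i}$ and $H_d(z)=F_d(z-1)=\sum_{i=0}^{d+1}H_{i,d}z^{d+1-i}$, defining $H_{i,d}$. *)

(* Defs.v *)
From HB Require Import structures.
From mathcomp Require Import all_boot all_order all_algebra all_field.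
Set Implicit Arguments. Unset Strict Implicit. Unset Printing Implicit Defensive.
Import Order.TTheory GRing.Theory Num.Theory.

Definition is_complex (T : finType) (D : {set {set T}}) : Prop :=
  set0 \in D /\ forall s t : {set T}, s \in D -> t \subset s -> t \in D.

Definition top (T : finType) (D : {set {set T}}) : nat := \max_(s in D) #|s|.
Definition dimc (T : finType) (D : {set {set T}}) : nat := (top D).-1.

(** [fsimp D i] = number of simplices of cardinality i, i.e. f_{i-1}. *)
Definition fsimp (T : finType) (D : {set {set T}}) (i : nat) : nat :=
  #|[set s in D | #|s| == i]|.

Definition rchi (T : finType) (D : {set {set T}}) : int :=
  \sum_(s in D) (-1) ^+ (#|s|.+1).

Local Open Scope ring_scope.

(** h-polynomial: sum_{i=-1}^d f_i (z-1)^(d-i); with j = i+1 and top = d+1. *)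
Definition hpoly (T : finType) (D : {set {set T}}) : {poly algC} :=
  \sum_(j < (top D).+1) (fsimp D j)%:R *: ('X - 1) ^+ (top D - j)%N.
Local Close Scope ring_scope.

(** Barycentric subdivision: empty set together with all nonempty chains
    (under strict inclusion) of nonempty simplices. A finite set of simplices
    totally ordered by inclusion is exactly such a chain. *)
Definition bary (T : finType) (D : {set {set T}}) : {set {set {set T}}} :=
  [set C : {set {set T}} | (C \subset D :\ set0) &&
     [forall s in C, forall t in C, (s \subset t) || (t \subset s)]].

Fixpoint itT (T : finType) (k : nat) : finType :=
  match k with 0 => T | k.+1 => {set itT T k} end.

Fixpoint baryk (T : finType) (D : {set {set T}}) (k : nat) : {set {set itT T k}} :=
  match k with 0 => D | k.+1 => bary (baryk D k) end.

Fixpoint stirling2 (n k : nat) : nat :=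
  match n, k with
  | 0, 0 => 1
  | 0, _.+1 => 0
  | _.+1, 0 => 0
  | n'.+1, k'.+1 => k'.+1 * stirling2 n' k'.+1 + stirling2 n' k'
  end.

(** [fnum a b] = f_{a-1,b-1} (shifted indices a = i+1, b = d+1). *)
Definition fnum (a b : nat) : nat :=
  if a == 0 then (b == 0 : nat)
  else if b == 0 then 0 else a`! * stirling2 b a.

Local Open Scope ring_scope.

(** [Fseq B m] = [:: F_{B-m-1,B-1}; ...; F_{B-1,B-1}] for m <= B. *)
Fixpoint Fseq (B m : nat) : seq algC :=
  match m with
  | 0 => [:: 1]
  | m'.+1 =>
      let s := Fseq B m' in
      let a := (B - m'.+1)%N in
      ((B`! - a`!)%:R)^-1 *
        (\sum_(j < size s) (fnum a (a + j.+1)%N)%:R * s`_j) :: s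
  end.

(** [Fcoef i d] = F_{i-1,d} (for 0 <= i <= d+1, d >= 0). *)
Definition Fcoef (i d : nat) : algC := head 0 (Fseq d.+1 (d.+1 - i)).

Definition Fpoly (d : nat) : {poly algC} :=
  \sum_(i < d.+2) Fcoef i d *: 'X ^+ (d.+1 - i)%N.

Definition Hpoly (d : nat) : {poly algC} := Fpoly d \Po ('X - 1).

Definition Hcoef (i d : nat) : algC := (Hpoly d)`_(d.+1 - i).

Definition asym (f g : nat -> algC) : Prop :=
  forall eps : algC, 0 < eps -> exists N : nat, forall k : nat, (N <= k)%N ->
    `|f k / g k - 1| < eps.

Definition tends_to_0 (e : nat -> algC) : Prop :=
  forall eps : algC, 0 < eps -> exists N : nat, forall k : nat, (N <= k)%N ->
    `|e k| < eps.

(* Main.v *)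
(** A chain of nonempty faces is determined by its maximum (its union), so [bary]
    acts on f-vectors by the triangular matrix [fnum], whose diagonal entries are
    the [a!]. Hence, with [n = d + 1], the f-vector of the k-th subdivision divided
    by [n!^k] tends to [f_d] times the eigenvector [F] of eigenvalue [n!].

    The inverse of [fnum] maps [x^a] to the binomial polynomial [binom(x, a)], and
    commutes with [x |-> -1 - x] by Vandermonde's identity. As the eigenvalue [n!] is
    simple, [E(x) = sum_a F_a x^a] satisfies [E(-1-x) = (-1)^n E(x)], which makes the
    coefficients of [z] and of [z^d] in [H_d] equal. Evaluating at [-1] also shows that
    the constant term of the h-polynomial is [rchi D] up to sign, for every k.

    So the h-polynomial is [z^n + p_d z^d + ... + p_1 z + p_0] where
    [p_d, p_1 ~ H_1 f_d n!^k], the other coefficients are [O(n!^k)] and [p_0] has constant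
    modulus. The largest root balances the two top terms, the smallest one the two
    bottom terms; that these roots are respectively large and small enough follows from
    Vieta's formulas. *)

Require Import Defs.
From HB Require Import structures.
From mathcomp Require Import all_boot all_order all_algebra all_field.
From mathcomp Require Import zify ring.
Import Order.TTheory GRing.Theory Num.Theory.
Set Implicit Arguments. Unset Strict Implicit. Unset Printing Implicit Defensive.

(** * Recurrences for [fnum], the number of surjections from a [b]-set onto an [a]-set *)

Lemma fnumE a b : fnum a b = (a`! * stirling2 b a)%N.
Proof. by case: a => [|a]; case: b => [|b] //=; rewrite /fnum /= ?muln0. Qed.

Lemma stirling2_gt n k : (n < k)%N -> stirling2 n k = 0%N.
Proof.
by elim: n k => [|n IHn] [|k] //= lt_nk; rewrite !IHn ?muln0 // ltnW.
Qed.

Lemma stirling2_diag n : stirling2 n n = 1%N.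
Proof. by elim: n => //= n ->; rewrite stirling2_gt ?muln0. Qed.

Lemma fnum_gt a b : (b < a)%N -> fnum a b = 0%N.
Proof. by move=> lt_ba; rewrite fnumE stirling2_gt ?muln0. Qed.

Lemma fnum_diag a : fnum a a = a`!.
Proof. by rewrite fnumE stirling2_diag muln1. Qed.

Lemma fnum0S b : fnum 0 b.+1 = 0%N.
Proof. by []. Qed.

Lemma fnumS a b : fnum a.+1 b.+1 = (a.+1 * (fnum a.+1 b + fnum a b))%N.
Proof. by rewrite !fnumE /= factS; lia. Qed.

(** Both sides count chains of [a] nonempty subsets of a [b]-set: the union of such a chain is
    either the whole set, or a proper subset, and then adding the whole set gives a chain of length
    [a + 1]. The formal proof is by Pascal's rule. *)
Lemma sum_bin_fnum b a :
  \sum_(i < b.+1) 'C(b, i) * fnum a i = (fnum a b + fnum a.+1 b)%N.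
Proof.
elim: b a => [|b IHb] a.
  by rewrite big_ord_recl big_ord0 bin0; case: a.
have -> : \sum_(i < b.+2) 'C(b.+1, i) * fnum a i =
    (\sum_(i < b.+1) 'C(b, i) * fnum a i + \sum_(i < b.+1) 'C(b, i) * fnum a i.+1)%N.
  rewrite big_ord_recl bin0 /=.
  under eq_bigr do rewrite /bump /= add1n binS mulnDl.
  rewrite big_split /= addnA; congr (_ + _)%N.
  by rewrite [in RHS]big_ord_recl bin0 [in LHS]big_ord_recr /= bin_small ?addn0.
case: a => [|a].
  rewrite IHb [X in (_ + X)%N]big1 => [|i _]; last by rewrite fnum0S muln0.
  by rewrite fnumS mul1n addn0 fnum0S addnC.
under [X in (_ + X)%N]eq_bigr do rewrite fnumS mulnCA mulnDr.
rewrite -big_distrr big_split /= !IHb !fnumS; lia.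
Qed.

(** * Chains of faces and the f-vector of one barycentric subdivision *)

Definition down_closed (T : finType) (D : {set {set T}}) :=
  forall s t : {set T}, s \in D -> t \subset s -> t \in D.

Lemma sum_card (V : nmodType) (T : finType) (D : {set {set T}}) (g : nat -> V) m :
    (forall s, s \in D -> #|s| < m)%N ->
  (\sum_(s in D) g #|s| = \sum_(b < m) g b *+ fsimp D b)%R.
Proof.
move=> ltm.
have -> : (\sum_(b < m) g b *+ fsimp D b =
    \sum_(b < m) \sum_(s in D) (if #|s| == b then g #|s| else 0))%R.
  apply: eq_bigr => b _; rewrite -big_mkcondr /= /fsimp -sumr_const.
  apply: eq_big => [s|s]; first by rewrite inE.
  by case/setIdP=> _ /eqP->.
rewrite exchange_big /=; apply: eq_bigr => s Ds.
rewrite (bigD1 (Ordinal (ltm _ Ds))) //= eqxx big1 ?addr0 // => i /negbTE.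
by rewrite -val_eqE /= eq_sym => ->.
Qed.

Lemma sum_card_nat (T : finType) (D : {set {set T}}) (g : nat -> nat) m :
    (forall s, s \in D -> #|s| < m)%N ->
  \sum_(s in D) g #|s| = \sum_(b < m) g b * fsimp D b.
Proof.
move=> /(sum_card g) -> /=; apply: eq_bigr => b _.
by rewrite -mulr_natr natn.
Qed.

Section Chains.
Variable T : finType.
Implicit Types (s t : {set T}) (C D : {set {set T}}).

Definition chain C :=
  (set0 \notin C) && [forall s in C, forall t in C, (s \subset t) || (t \subset s)].

Lemma chainP C : reflect (set0 \notin C /\ {in C &, forall s t, (s \subset t) || (t \subset s)})
  (chain C).
Proof.
apply: (iffP andP) => -[C0 cC]; split=> //.
  by move=> s t Cs Ct; move/forall_inP/(_ s Cs)/forall_inP/(_ t Ct): cC.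
by apply/forall_inP=> s Cs; apply/forall_inP=> t Ct; apply: cC.
Qed.

Lemma in_bary D C : (C \in bary D) = (C \subset D) && chain C.
Proof. by rewrite inE subsetD1 /chain andbA. Qed.

(** A member of largest cardinality contains all the others, hence is the union. *)
Lemma cover_chain_in C : chain C -> C != set0 -> cover C \in C.
Proof.
case/chainP=> _ cC /set0Pn[s0 Cs0].
have [s Cs smax] := arg_maxnP (fun s : {set T} => #|s|) Cs0.
suff -> : cover C = s by [].
apply/eqP; rewrite eqEsubset (bigcup_sup s) // andbT.
apply/bigcupsP=> t Ct; have /orP[//|st] := cC t s Ct Cs.
suff /eqP-> : s == t by [].
by rewrite eqEcard st; apply: smax.
Qed.

(** For [a > 0] the union is the maximum, so these are the chains with top element [s]; using
    [cover] avoids choosing a maximum. *)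
Definition nchain s a := #|[set C | [&& chain C, cover C == s & #|C| == a]]|.

(** Faces are sorted by their union, itself a face of [D]; conversely, down-closure puts every
    member of a chain with union [s] in [D]. *)
Lemma fsimp_bary D a : down_closed D -> (0 < a)%N ->
  fsimp (bary D) a = \sum_(s in D) nchain s a.
Proof.
move=> dD a_gt0; rewrite /fsimp -sum1_card (partition_big (@cover T) (mem D)) /=.
  apply: eq_bigr => s Ds; rewrite /nchain -sum1_card; apply: eq_bigl => C.
  rewrite !inE -!andbA -[X in X && _]/(C \subset D :\ set0) subsetD1 /chain.
  rewrite -!andbA; apply/and5P/and4P => [[CD C0 cC Ca /eqP Cs]|[C0 cC Cs Ca]].
    by split=> //; apply/eqP.
  split=> //; apply/subsetP=> t Ct; apply: (dD s) => //.
  by rewrite -(eqP Cs); apply: (bigcup_sup t).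
move=> C /setIdP[]; rewrite in_bary => /andP[/subsetP CD cC] /eqP Ca.
by apply: CD; apply: cover_chain_in => //; rewrite -card_gt0 Ca.
Qed.

Lemma nchain1 s : nchain s 1 = (s != set0).
Proof.
rewrite /nchain; have [-> | s0] := eqVneq s set0.
  apply/eqP; rewrite cards_eq0; apply/eqP/setP=> C; rewrite !inE.
  apply/negP=> /and3P[cC /eqP C0 /eqP C1].
  have := @cover_chain_in C cC; rewrite -card_gt0 C1 C0 => /(_ isT).
  by case/chainP: cC => /negP.
rewrite -[RHS](cards1 [set s]); apply: eq_card => C; rewrite !inE.
apply/and3P/eqP => [[cC /eqP Cs /cards1P[t Ct]] | ->].
  by rewrite -Cs Ct /cover big_set1.
split; rewrite ?cards1 //; last by rewrite /cover big_set1.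
apply/chainP; split; first by rewrite inE eq_sym.
by move=> ? ? /set1P-> /set1P->; rewrite subxx.
Qed.

Lemma nchain_set0 a : (0 < a)%N -> nchain set0 a = 0%N.
Proof.
move=> a_gt0; apply/eqP; rewrite cards_eq0; apply/eqP/setP=> C; rewrite !inE.
apply/negP=> /and3P[cC /eqP C0 /eqP Ca].
have := @cover_chain_in C cC; rewrite -card_gt0 Ca C0 => /(_ a_gt0).
by case/chainP: cC => /negP.
Qed.

(** Removing the top element [s] leaves a face of the subdivided boundary of the simplex [s]. *)
Lemma nchainS s a : s != set0 ->
  nchain s a.+1 = fsimp (bary (powerset s :\ s)) a.
Proof.
move=> s0; rewrite /nchain /fsimp.
have sN C : C \in bary (powerset s :\ s) -> s \notin C.
  rewrite in_bary => /andP[/subsetP CD _]; apply/negP=> /CD.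
  by rewrite !inE eqxx.
rewrite -[RHS](card_in_imset (f := fun C => s |: C)); last first.
  move=> C1 C2 /setIdP[/sN s1 _] /setIdP[/sN s2 _] /(congr1 (fun C => C :\ s)).
  by rewrite !setU1K.
apply: eq_card => C; apply/idP/imsetP => [|[C' /setIdP[C'D /eqP C'a] ->]].
  rewrite inE => /and3P[cC /eqP Cs /eqP Ca].
  have sC : s \in C by rewrite -[X in X \in _]Cs; apply: cover_chain_in; rewrite // -card_gt0 Ca.
  exists (C :\ s); last by rewrite setD1K.
  have [C0 ccC] := chainP _ cC.
  rewrite inE in_bary; apply/andP; split; last by have := cardsD1 s C; rewrite sC Ca add1n => -[->].
  apply/andP; split.
    apply/subsetP=> t /setD1P[ts Ct]; rewrite !inE ts /= -Cs.
    by apply: (bigcup_sup t).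
  apply/chainP; split; first by rewrite !inE negb_and C0 orbT.
  by move=> t u /setD1P[_ Ct] /setD1P[_ Cu]; apply: ccC.
have sC' := sN _ C'D.
rewrite inE cardsU1 sC' C'a eqxx andbT.
move: C'D; rewrite in_bary => /andP[/subsetP C'D /chainP[C0 ccC]].
have sub t : t \in C' -> t \subset s by move=> /C'D; rewrite !inE => /andP[].
apply/andP; split.
  apply/chainP; split; first by rewrite !inE negb_or C0 eq_sym s0.
  move=> t u /setU1P[->|Ct] /setU1P[->|Cu]; rewrite ?subxx ?sub ?orbT //.
  exact: ccC.
rewrite eqEsubset; apply/andP; split.
  by apply/bigcupsP=> t /setU1P[->|/sub].
by apply: (bigcup_sup s) => //; rewrite setU11.
Qed.

Lemma fsimp_powerset s b : fsimp (powerset s) b = 'C(#|s|, b).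
Proof.
by rewrite -cards_draws /fsimp; apply: eq_card => t; rewrite !inE.
Qed.

Lemma nchainE s a : (0 < a)%N -> nchain s a = fnum a #|s|.
Proof.
case: a => // a _; elim: a s => [|a IHa] s; have [-> | s0] := eqVneq s set0.
- by rewrite nchain_set0 // cards0.
- rewrite nchain1 s0; move: s0; rewrite -card_gt0; elim: #|s| => // -[|b] IHb _ //.
  by rewrite fnumS -IHb.
- by rewrite nchain_set0 // cards0.
rewrite nchainS // fsimp_bary //; last first.
  move=> t u; rewrite !inE => /andP[ts t_s] ut.
  rewrite (subset_trans ut t_s) andbT; apply: contra ts => /eqP us.
  by rewrite eqEsubset t_s -us ut.
under eq_bigr do rewrite IHa.
(* Over all subsets of [s] the sum is known from [sum_bin_fnum]; cancelling the term [t = s] leaves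
   the sum over the boundary. *)
have : \sum_(t in powerset s) fnum a.+1 #|t| = fnum a.+1 #|s| + fnum a.+2 #|s|.
  rewrite (@sum_card_nat _ _ (fnum a.+1) #|s|.+1) => [|t]; last first.
    by rewrite inE ltnS => /subset_leq_card.
  by rewrite -sum_bin_fnum; apply: eq_bigr => i _; rewrite fsimp_powerset mulnC.
rewrite (big_setD1 s) /=; last by rewrite inE.
exact: addnI.
Qed.

End Chains.

(** * Dimension and f-vectors of iterated subdivisions *)

Lemma fsimp_baryE (T : finType) (D : {set {set T}}) a m :
    down_closed D -> (forall s, s \in D -> #|s| < m)%N -> (0 < a)%N ->
  fsimp (bary D) a = \sum_(b < m) fnum a b * fsimp D b.
Proof.
move=> dD ltm a_gt0; rewrite fsimp_bary // -(@sum_card_nat _ _ (fnum a)) //.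
by apply: eq_bigr => s _; rewrite nchainE.
Qed.

Lemma fsimp0 (T : finType) (D : {set {set T}}) : set0 \in D -> fsimp D 0 = 1%N.
Proof.
move=> D0; apply/eqP/cards1P; exists set0; apply/setP=> s.
by rewrite !inE cards_eq0; case: eqVneq => [->|]; rewrite ?D0 ?andbF.
Qed.

Lemma bary_complex (T : finType) (D : {set {set T}}) : is_complex (bary D).
Proof.
split=> [|C C']; rewrite !in_bary.
  by rewrite sub0set; apply/chainP; split=> [|s t]; rewrite inE.
case/andP=> CD /chainP[C0 cC] /[dup] sC /subsetP C'C; rewrite (subset_trans sC) //=.
by apply/chainP; split=> [|s t /C'C Cs /C'C Ct]; [apply: contra C0 => /C'C | apply: cC].
Qed.

Lemma ltn_top (T : finType) (D : {set {set T}}) s : s \in D -> (#|s| < (top D).+1)%N.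
Proof. by move=> Ds; rewrite ltnS /top (bigD1 s) //= leq_maxl. Qed.

Lemma fsimp_top (T : finType) (D : {set {set T}}) : set0 \in D -> (0 < fsimp D (top D))%N.
Proof.
move=> D0; have D_gt0 : (0 < #|D|)%N by apply/card_gt0P; exists set0.
have [s Ds sE] := @eq_bigmax_cond _ (mem D) (fun s : {set T} => #|s|) D_gt0.
by apply/card_gt0P; exists s; rewrite inE [s \in D]Ds /top sE eqxx.
Qed.

Lemma top_fsimp (T : finType) (D : {set {set T}}) n :
  (0 < fsimp D n)%N -> (forall a, (n < a)%N -> fsimp D a = 0%N) -> top D = n.
Proof.
move=> /card_gt0P[s /setIdP[Ds /eqP sn]] D_gt; apply/eqP; rewrite eqn_leq; apply/andP; split.
  apply/bigmax_leqP=> t Dt; rewrite leqNgt; apply/negP=> /D_gt/eqP.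
  by rewrite cards_eq0 => /eqP/setP/(_ t); rewrite !inE Dt eqxx.
by rewrite -sn -ltnS ltn_top.
Qed.

(** Since [fnum] is triangular with nonzero diagonal, the last nonzero entry of the f-vector stays
    in place. *)
Lemma top_bary (T : finType) (D : {set {set T}}) :
  is_complex D -> (0 < top D)%N -> top (bary D) = top D.
Proof.
move=> [D0 dD] n_gt0; apply: top_fsimp => [|a lta];
  rewrite (@fsimp_baryE _ _ _ (top D).+1) // ?(leq_trans _ lta) //; try exact: ltn_top.
- rewrite big_ord_recr /= fnum_diag addn_gt0 muln_gt0 fact_gt0 fsimp_top //.
  by rewrite orbT.
- by rewrite big1 // => i _; rewrite fnum_gt // (leq_trans (ltn_ord i)).
Qed.

Lemma baryk_complex (T : finType) (D : {set {set T}}) k : is_complex D -> is_complex (baryk D k).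
Proof. by case: k => // k _; apply: bary_complex. Qed.

Lemma top_baryk (T : finType) (D : {set {set T}}) k :
  is_complex D -> (0 < top D)%N -> top (baryk D k) = top D.
Proof.
move=> cD n_gt0; elim: k => //= k IHk; rewrite top_bary ?IHk //.
exact: baryk_complex.
Qed.

Lemma fsimp_baryk (T : finType) (D : {set {set T}}) k a :
    is_complex D -> (0 < top D)%N ->
  fsimp (baryk D k.+1) a = \sum_(b < (top D).+1) fnum a b * fsimp (baryk D k) b.
Proof.
move=> cD n_gt0; have [D0 dD] := baryk_complex k cD.
(* Row [0] of [fnum] is [1, 0, 0, ...], which matches the single empty face. *)
case: a => [|a].
  rewrite fsimp0; last by case: (baryk_complex k.+1 cD).
  by rewrite big_ord_recl fsimp0 //= big1 // => i _; rewrite fnum0S.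
rewrite [LHS](@fsimp_baryE _ _ _ (top D).+1) // => s.
by rewrite -(top_baryk k) //; apply: ltn_top.
Qed.

(** The factorial fails to increase strictly only at [0! = 1!], which [1 < n] excludes. *)
Lemma ltn_fact_gt1 m n : (1 < n)%N -> (m < n)%N -> (m`! < n`!)%N.
Proof.
by case: m => [n1 _|m _ mn]; [apply: leq_trans n1 (fact_geq n) | apply: ltn_fact].
Qed.

Local Open Scope ring_scope.

(** * Binomial polynomials and the reflection [x |-> -1 - x] *)

Section FallingFactorials.
Variable F : numFieldType.
Implicit Type p : {poly F}.

Definition ffp a : {poly F} := \prod_(i < a) ('X - i%:R%:P).

Lemma mulX_ffp a : 'X * ffp a = ffp a.+1 + a%:R *: ffp a.
Proof.
rewrite /ffp big_ord_recr /= mulrBr -mul_polyC.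
by rewrite mulrC [_ * a%:R%:P]mulrC subrK.
Qed.

Lemma monic_ffp a : ffp a \is monic.
Proof. exact: monic_prod_XsubC. Qed.

Lemma size_ffp a : size (ffp a) = a.+1.
Proof. by rewrite /ffp size_prod_XsubC /index_enum -enumT size_enum_ord. Qed.

(** The polynomial [binom(X, a)]. *)
Definition binp a : {poly F} := (a`!%:R)^-1 *: ffp a.

Lemma binp0 : binp 0 = 1.
Proof. by rewrite /binp /ffp big_ord0 fact0 invr1 scale1r. Qed.

Lemma factF_neq0 a : (a`!%:R : F) != 0.
Proof. by rewrite pnatr_eq0 -lt0n fact_gt0. Qed.

Lemma mulX_binp a : 'X * binp a = a.+1%:R *: binp a.+1 + a%:R *: binp a.
Proof.
rewrite /binp -scalerAr mulX_ffp scalerDr !scalerA; congr (_ *: _ + _ *: _).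
  by rewrite factS natrM invfM mulVKf // pnatr_eq0.
exact: mulrC.
Qed.

(** Together with [Xn_binp], this makes the Euler characteristic invariant under subdivision. *)
Lemma hornerN1_binp a : (binp a).[-1] = (-1) ^+ a.
Proof.
elim: a => [|a IHa]; first by rewrite binp0 hornerC.
have /(congr1 (fun p => p.[-1])) := mulX_binp a.
rewrite hornerM hornerD !(hornerZ _ (binp _)) hornerX IHa => /(canLR (addrK _)) E.
have a1 : a.+1%:R != 0 :> F by rewrite pnatr_eq0.
by apply: (mulfI a1); rewrite -E exprS -natr1; ring.
Qed.

(** The classical Stirling expansion: multiplication by ['X] acts on binomial polynomials by the
    recurrence [fnumS]. *)
Lemma Xn_binp b m : (b < m)%N ->
  'X^b = \sum_(a < m) (fnum a b)%:R *: binp a.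
Proof.
elim: b m => [|b IHb] [|m] // ltbm.
  rewrite big_ord_recl big1 => [|i _]; last by rewrite scale0r.
  by rewrite addr0 binp0 scale1r expr0.
rewrite exprS (IHb m.+1) ?(ltn_trans _ ltbm) // mulr_sumr.
under eq_bigr do rewrite -scalerAr mulX_binp scalerDr !(scalerA _ _ (binp _)).
rewrite big_split /= big_ord_recr big_ord_recl /= mulr0 scale0r add0r.
rewrite (@fnum_gt m b) // mul0r scale0r addr0.
rewrite [RHS]big_ord_recl fnum0S scale0r add0r -big_split /=.
apply: eq_bigr => i _; rewrite -scalerDl fnumS; congr (_ *: _).
by rewrite natrM natrD mulrDr addrC; congr (_ + _); rewrite mulrC.
Qed.

(** By Vandermonde the sum on the left is [binom(X + a, a)], so this is [(X + a + 1) binom(X + a, a)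
    = (a + 1) binom(X + a + 1, a + 1)]. *)
Lemma binp_refl_rec a m : (a < m)%N ->
  (\sum_(j < m.+1) 'C(a, j)%:R *: binp j) * ('X + a.+1%:R%:P) =
  a.+1%:R *: \sum_(j < m.+1) 'C(a.+1, j)%:R *: binp j.
Proof.
move=> ltam; rewrite mulrC mulr_sumr scaler_sumr.
under eq_bigr do
  rewrite mulrDl -scalerAr mulX_binp mul_polyC !scalerDr !(scalerA _ _ (binp _)) -addrA -scalerDl.
rewrite big_split /= big_ord_recr /= bin_small // mul0r scale0r addr0.
rewrite [X in _ + X]big_ord_recl [RHS]big_ord_recl /= !bin0 addrCA; congr (_ + _).
  by rewrite (scalerA _ _ (binp _)) mulr0 add0r.
rewrite -big_split /=; apply: eq_bigr => i _; rewrite -scalerDl (scalerA _ _ (binp _)); congr (_ *: _).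
have := mul_bin_left a i.
rewrite /bump /= add1n -!natrM -!natrD => h; congr (_%:R); rewrite binS.
(* The difference [a - i] in [mul_bin_left] is truncated, so [i = a] and [i > a] are treated
   apart. *)
have [lt|] := ltnP i a; first by nia.
by move=> /[dup] le; rewrite leq_eqVlt => /orP[/eqP<-|lt]; rewrite ?binn !bin_small //; nia.
Qed.

(** Upper negation gives [(-1)^a binom(X + a, a)], here in its Vandermonde expansion. *)
Lemma binp_refl a m : (a < m)%N ->
  binp a \Po (- 1 - 'X) = (-1) ^+ a *: \sum_(j < m) 'C(a, j)%:R *: binp j.
Proof.
elim: a m => [|a IHa] [|m] // ltam.
  rewrite big_ord_recl big1 => [|i _]; last by rewrite bin0n scale0r.
  rewrite addr0 expr0 /= !scale1r binp0.
  by rewrite -[1]/(1%:P) comp_polyC.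
have a1 : a.+1%:R != 0 :> F by rewrite pnatr_eq0.
apply: (scalerI a1); rewrite -comp_polyZ [RHS]scalerA [a.+1%:R * _]mulrC -[RHS]scalerA -binp_refl_rec //.
have -> : a.+1%:R *: binp a.+1 = binp a * ('X - a%:R%:P).
  by rewrite mulrBr mulrC mulX_binp [binp a * _]mulrC mul_polyC addrK.
rewrite comp_polyM (IHa m.+1) ?(ltn_trans _ ltam) //.
rewrite comp_polyB comp_polyX comp_polyC.
have -> : - 1 - 'X - a%:R%:P = - ('X + a.+1%:R%:P) :> {poly F}.
  by rewrite -natr1 polyCD polyC1; ring.
by rewrite mulrN -scalerAl exprS mulN1r scaleNr.
Qed.

(* The inverse of the f-vector transformation [fnum], truncated to degree [n]: [x^a |-> binom(x, a)]. *)
Definition binm n p : {poly F} := \sum_(a < n.+1) p`_a *: binp a.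

Lemma binm_is_linear n : linear (binm n).
Proof.
move=> c p q; rewrite /binm scaler_sumr -big_split /=; apply: eq_bigr => i _.
by rewrite coefD coefZ scalerDl scalerA.
Qed.
HB.instance Definition _ n :=
  GRing.isLinear.Build F {poly F} {poly F} _ (binm n) (binm_is_linear n).

Lemma binmXn n a : (a <= n)%N -> binm n 'X^a = binp a.
Proof.
move=> an; rewrite /binm (bigD1 (Ordinal (an : (a < n.+1)%N))) //= coefXn eqxx scale1r.
rewrite big1 ?addr0 // => i /negbTE; rewrite -val_eqE /= coefXn => ->.
exact: scale0r.
Qed.

Lemma poly_sumXn n p : (size p <= n.+1)%N -> p = \sum_(a < n.+1) p`_a *: 'X^a.
Proof.
move=> sp; rewrite -poly_def; apply/polyP=> i; rewrite coef_poly.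
by case: ltnP => // lt; rewrite nth_default // (leq_trans sp).
Qed.

Lemma reflXn a : (- 1 - 'X) ^+ a = (-1) ^+ a *: \sum_(j < a.+1) 'C(a, j)%:R *: 'X^j :> {poly F}.
Proof.
rewrite -opprD [LHS]exprNn -[RHS]mul_polyC rmorphXn /= rmorphN1; congr (_ * _).
rewrite exprDn; apply: eq_bigr => i _; rewrite expr1n mul1r.
by rewrite scaler_nat.
Qed.

(** On ['X^a]: the coefficients of [(-1 - X)^a] on powers of ['X] are those of [binp_refl] on
    binomial polynomials. *)
Lemma binm_refl n p : (size p <= n.+1)%N ->
  binm n (p \Po (- 1 - 'X)) = binm n p \Po (- 1 - 'X).
Proof.
move=> sp; rewrite [in LHS](poly_sumXn sp) [in RHS]/binm !(linear_sum (comp_poly _)) linear_sum.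
apply: eq_bigr => -[a /= an] _.
rewrite [in LHS]comp_polyZ [in RHS]comp_polyZ [in LHS]linearZ /=; congr (_ *: _).
rewrite comp_Xn_poly reflXn linearZ /= (binp_refl (m := a.+1)) //.
congr (_ *: _); rewrite [LHS]linear_sum; apply: eq_bigr => -[j /= ja] _.
by rewrite linearZ /= binmXn // -ltnS (leq_trans ja).
Qed.

(* In degree [m] the eigenvalue of [binm] is [1 / m!], so [n!] is only compatible with degree [n]. *)
Lemma binm_eigen_eq0 n p : (1 < n)%N -> (size p <= n)%N ->
  n`!%:R *: binm n p = p -> p = 0.
Proof.
move=> n_gt1 sp Ep; apply/eqP/negPn/negP => p0.
have : lead_coef p != 0 by rewrite lead_coef_eq0.
set m := (size p).-1; have szp : size p = m.+1 by rewrite /m prednK // size_poly_gt0.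
have lmn : (m < n)%N by rewrite -szp.
have := congr1 (fun q : {poly F} => q`_m) Ep; rewrite /binm coefZ coef_sum.
(* In degree [m] only [binp m] contributes: smaller indices have smaller degree, larger ones have
   coefficient zero in [p]. What remains is [n! / m! = 1]. *)
rewrite (bigD1 (Ordinal (leqW lmn : (m < n.+1)%N))) //= big1 => [|i]; last first.
  rewrite -val_eqE /= neq_ltn => /orP[] im; rewrite coefZ.
    by rewrite coefZ [(ffp i)`_m]nth_default ?mulr0 // size_ffp.
  by rewrite nth_default ?mul0r // szp.
rewrite addr0 !coefZ; have -> : (ffp m)`_m = 1.
  by have /monicP := monic_ffp m; rewrite lead_coefE size_ffp.
rewrite mulr1 lead_coefE -/m => /eqP; rewrite mulrCA -subr_eq0 -[X in _ - X]mulr1 -mulrBr.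
rewrite mulf_eq0 => /orP[->//|]; rewrite subr_eq0 => /eqP h.
have /eqP : n`!%:R = m`!%:R :> F.
  by apply: (mulIf (invr_neq0 (factF_neq0 m))); rewrite h mulfV // factF_neq0.
rewrite eqr_nat => /eqP nm; by have := ltn_fact_gt1 n_gt1 lmn; rewrite nm ltnn.
Qed.

End FallingFactorials.

(** * The eigenvector [Fcoef] and the symmetry of [Hpoly] *)

Lemma size_Fseq B m : size (Fseq B m) = m.+1.
Proof. by elim: m => //= m ->. Qed.

Lemma nth_Fseq B m j : (j <= m)%N -> (Fseq B m)`_j = head 0 (Fseq B (m - j)).
Proof.
elim: m j => [|m IHm] [|j] // jm; exact: IHm.
Qed.

Lemma Fcoef_top d : Fcoef d.+1 d = 1.
Proof. by rewrite /Fcoef subnn. Qed.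

Lemma Fcoef_rec d a : (a <= d)%N ->
  Fcoef a d = ((d.+1`! - a`!)%:R)^-1 *
     \sum_(j < d.+1 - a) (fnum a (a + j.+1))%:R * Fcoef (a + j.+1) d.
Proof.
move=> ad; rewrite {1}/Fcoef subSn //= subSS subKn // size_Fseq; congr (_ * _).
apply: eq_bigr => -[j /= jd] _; congr (_ * _).
by rewrite nth_Fseq // /Fcoef; congr (head _ (Fseq _ _)); lia.
Qed.

(** This is the defining recursion with the diagonal term [a! F_a] moved across; [0 < d] ensures
    that [(d+1)! - a!] is nonzero for [a <= d]. *)
Lemma Fcoef_eigen d a : (0 < d)%N -> (a <= d.+1)%N ->
  (d.+1)`!%:R * Fcoef a d = \sum_(b < d.+2) (fnum a b)%:R * Fcoef b d.
Proof.
move=> d_gt0; rewrite leq_eqVlt => /orP[/eqP->|]; last rewrite ltnS => ad.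
  rewrite big_ord_recr /= big1 ?add0r ?fnum_diag // => i _.
  by rewrite fnum_gt ?mul0r.
have lt : (a`! < d.+1`!)%N by apply: ltn_fact_gt1.
have -> : \sum_(b < d.+2) (fnum a b)%:R * Fcoef b d =
   a`!%:R * Fcoef a d + \sum_(j < d.+1 - a) (fnum a (a + j.+1))%:R * Fcoef (a + j.+1) d.
  rewrite -(big_mkord xpredT (fun b => (fnum a b)%:R * Fcoef b d)).
  rewrite (@big_cat_nat _ _ _ a) //=; last by lia.
  rewrite big_nat big1 => [|i /andP[_ ia]]; last by rewrite fnum_gt // mul0r.
  rewrite add0r big_ltn; last by lia.
  rewrite fnum_diag -[a.+1]add0n big_addn big_mkord; congr (_ + _).
  have -> : (d.+2 - a.+1 = d.+1 - a)%N by lia.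
  by apply: eq_bigr => i _; rewrite -addSnnS addnC.
rewrite -[X in _ = _ + X](mulVKf (x := (d.+1`! - a`!)%:R)); last first.
  by rewrite pnatr_eq0 subn_eq0 -ltnNge.
rewrite -Fcoef_rec // -mulrDl -natrD subnKC //; exact: ltnW.
Qed.

Lemma Fcoef_ge0 d a : (a <= d.+1)%N -> 0 <= Fcoef a d.
Proof.
move=> ad; have [m] := ubnP (d.+1 - a); elim: m a ad => // m IHm a ad lem.
move: ad; rewrite leq_eqVlt => /orP[/eqP->|]; first by rewrite Fcoef_top ler01.
rewrite ltnS => ad; rewrite Fcoef_rec // mulr_ge0 ?invr_ge0 ?ler0n // sumr_ge0 // => -[j /= jd] _.
by rewrite mulr_ge0 ?ler0n // IHm; lia.
Qed.

Lemma Fcoef0 d : (0 < d)%N -> Fcoef 0 d = 0.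
Proof.
by move=> d_gt0; rewrite Fcoef_rec // big1 ?mulr0 // => i _; rewrite add0n fnum0S mul0r.
Qed.

Lemma Fcoef1_gt0 d : (0 < d)%N -> 0 < Fcoef 1 d.
Proof.
move=> d_gt0; rewrite Fcoef_rec // mulr_gt0 //.
  by rewrite invr_gt0 ltr0n subn_gt0 ltn_fact_gt1.
(* The last term of the recursion is positive, its factor [Fcoef] being the top entry [1]; the other
   terms are nonnegative. *)
case: d d_gt0 => // d _; rewrite subSS subn0 big_ord_recr /= add1n Fcoef_top mulr1.
rewrite ltr_wpDl ?sumr_ge0 ?ltr0n // => [[j /= jd] _|].
  by rewrite mulr_ge0 ?ler0n // Fcoef_ge0; lia.
by rewrite fnumE mul1n; elim: d.+1 => // m IHm; rewrite [stirling2 _ _]/= mul1n addn0.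
Qed.

(* The reversal of [Fpoly d]: the paper's [F_d(z)] is [z^(d+1) E(1/z)]. *)
Definition Epoly d : {poly algC} := \poly_(a < d.+2) Fcoef a d.

Lemma coef_Epoly d a : (a <= d.+1)%N -> (Epoly d)`_a = Fcoef a d.
Proof. by move=> ad; rewrite coef_poly ltnS ad. Qed.

(** Expanding each ['X^b] by [Xn_binp], the coefficient of [binp a] is row [a] of [fnum] applied to
    [Fcoef]. *)
Lemma Epoly_eigen d : (0 < d)%N -> (d.+1)`!%:R *: binm d.+1 (Epoly d) = Epoly d.
Proof.
move=> d_gt0; rewrite scaler_sumr [RHS]poly_def.
under [RHS]eq_bigr => b _ do rewrite (Xn_binp algC (ltn_ord b)) scaler_sumr.
rewrite exchange_big /=; apply: eq_bigr => -[a /= ad] _.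
rewrite scalerA coef_Epoly // Fcoef_eigen // scaler_suml; apply: eq_bigr => b _.
by rewrite [RHS]scalerA mulrC.
Qed.

Lemma size_refl : size (- 1 - 'X : {poly algC}) = 2.
Proof. by rewrite -opprD size_polyN addrC -polyC1 size_XaddC. Qed.

Lemma size_comp_refl (p : {poly algC}) : size (p \Po (- 1 - 'X)) = size p.
Proof. by rewrite size_comp_poly2 // size_refl. Qed.

(* Both sides are eigenvectors of [binm] for [1 / n!] with the same leading coefficient. *)
Lemma Epoly_refl d : (0 < d)%N -> Epoly d \Po (- 1 - 'X) = (-1) ^+ d.+1 *: Epoly d.
Proof.
move=> d_gt0; apply/eqP; rewrite -subr_eq0; apply/eqP.
have szE : (size (Epoly d) <= d.+2)%N by exact: size_poly.
apply: (@binm_eigen_eq0 _ d.+1) => //; last first.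
  by rewrite linearB linearZ /= binm_refl // scalerBr scalerA mulrC -scalerA -comp_polyZ Epoly_eigen.
have szE' : size (Epoly d) = d.+2.
  apply/eqP; rewrite eqn_leq szE ltnNge; apply/negP => /leq_sizeP/(_ d.+1 (leqnn _))/eqP.
  by rewrite coef_Epoly // Fcoef_top oner_eq0.
have lcl : lead_coef (- 1 - 'X : {poly algC}) = - 1 :> algC.
  by rewrite -opprD lead_coefN addrC lead_coefDl ?lead_coefX // size_polyX size_poly1.
have szl : (1 < size (- 1 - 'X : {poly algC})%R)%N by rewrite size_refl.
apply/leq_sizeP => j; rewrite leq_eqVlt => /orP[/eqP<-|lt]; last first.
  rewrite coefB coefZ !nth_default ?size_comp_refl ?szE' //.
  by rewrite mulr0 subr0.
have := lead_coef_comp (Epoly d) szl.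
rewrite !lead_coefE size_comp_refl szE' /= -lead_coefE lcl coefB coefZ => ->.
by rewrite mulrC subrr.
Qed.

Lemma coef1_horner (p : {poly algC}) : p`_1 = p^`().[0].
Proof. by rewrite horner_coef0 coef_deriv mulr1n. Qed.

Lemma size_expXsubC1 m : size (('X - 1 : {poly algC}) ^+ m) = m.+1.
Proof. by rewrite -polyC1 size_exp_XsubC. Qed.

Lemma Hpoly_sum d : Hpoly d = \sum_(i < d.+2) Fcoef i d *: ('X - 1) ^+ (d.+1 - i)%N.
Proof.
rewrite /Hpoly /Fpoly linear_sum; apply: eq_bigr => i _.
by rewrite linearZ /= comp_Xn_poly.
Qed.

(** As [Fcoef 0 d] vanishes, the only term reaching degree [d] is [i = 1], and its power of ['X - 1]
    is monic. *)
Lemma Hcoef1 d : (0 < d)%N -> Hcoef 1 d = Fcoef 1 d.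
Proof.
move=> d_gt0; rewrite /Hcoef Hpoly_sum coef_sum subSS subn0.
rewrite big_ord_recl Fcoef0 // scale0r coef0 add0r big_ord_recl /= big1 => [|i _].
  have /monicP := monic_exp d (monicXsubC (1 : algC)).
  by rewrite polyC1 lead_coefE size_expXsubC1 /= addr0 coefZ subSS subn0 => ->; rewrite mulr1.
rewrite coefZ nth_default ?mulr0 // size_expXsubC1 /bump /=; lia.
Qed.

(* The reflection [E(-1-x) = (-1)^n E(x)] is the symmetry [H_i = H_(n-i)]; here [i = 1]. *)
Lemma Hpoly_coef1 d : (0 < d)%N -> (Hpoly d)`_1 = Fcoef 1 d.
Proof.
move=> d_gt0; have E := Epoly_refl d_gt0.
have E1 : (Epoly d).[-1] = 0.
  have := congr1 (fun p => p.[0]) E.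
  rewrite horner_comp !hornerE oppr0 addr0 horner_coef0 coef_Epoly // Fcoef0 // mulr0.
  done.
(* The reflection identity, differentiated and evaluated at [0]. *)
have dE1 : - (Epoly d)^`().[-1] = (-1) ^+ d.+1 * Fcoef 1 d.
  have := congr1 (fun p => p^`().[0]) E.
  rewrite deriv_comp !derivE !hornerE horner_comp !hornerE -coef1_horner coef_Epoly //.
  by rewrite subr0 oppr0 sub0r mulrN1.
(* At [m = 0] the truncated exponent is harmless, since the multiplicity is zero. *)
have signP m : (-1) ^+ m.-1 *+ m = - ((-1) ^+ m *+ m) :> algC.
  by case: m => [|m]; rewrite ?oppr0 // exprS mulN1r mulNrn opprK.
rewrite -[RHS]mul1r -[1](sqrr_sign _ d.+1) expr2 -mulrA -dE1 coef1_horner Hpoly_sum.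
rewrite raddf_sum horner_sum /Epoly poly_def raddf_sum horner_sum.
move: E1; rewrite /Epoly poly_def horner_sum => E1.
(* With [n = d + 1], the coefficient of [z] is [- (-1)^n (n E(-1) + E'(-1))]; the vanishing [E(-1)]
   is inserted so that the sums agree term by term. *)
rewrite -[RHS]addr0 -[X in _ = _ + X](mulr0 (- ((-1) ^+ d.+1 * d.+1%:R))) -[X in _ = _ + _ * X]E1.
rewrite -sumrN !mulr_sumr -big_split /=; apply: eq_bigr => -[i /= id] _.
rewrite !derivZ !hornerZ -polyC1 deriv_exp derivXsubC mul1r hornerMn horner_exp hornerXsubC.
rewrite derivXn hornerMn hornerXn sub0r (signP i) (signP (d.+1 - i)%N).
rewrite -[((-1) ^+ (d.+1 - i)) *+ _]mulr_natr.
rewrite -[((-1) ^+ i) *+ _]mulr_natr.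
have -> : (-1) ^+ (d.+1 - i) = (-1) ^+ d.+1 * (-1) ^+ i :> algC.
  by rewrite -signr_odd oddB // signr_addb !signr_odd.
by rewrite hornerXn natrB //; ring.
Qed.

(** * Null sequences *)

Implicit Types x y : nat -> algC.

Lemma eq_tends_to_0 x y : x =1 y -> tends_to_0 x -> tends_to_0 y.
Proof. by move=> xy x0 e /x0[N xN]; exists N => k /xN; rewrite xy. Qed.

Lemma tends_to_0_le C x y N : 0 <= C -> (forall k, (N <= k)%N -> `|x k| <= C * `|y k|) ->
  tends_to_0 y -> tends_to_0 x.
Proof.
move=> C_ge0 xy y0 e e_gt0.
have C1 : 0 < C + 1 by rewrite ltr_wpDl.
have [|N' yN] := y0 (e / (C + 1)); first by rewrite divr_gt0.
exists (maxn N N') => k; rewrite geq_max => /andP[/xy xk /yN yk].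
apply: le_lt_trans xk _; apply: (@le_lt_trans _ _ ((C + 1) * `|y k|)).
  by rewrite ler_wpM2r // lerDl.
by rewrite mulrC -ltr_pdivlMr.
Qed.

Lemma tends_to_0D x y : tends_to_0 x -> tends_to_0 y -> tends_to_0 (fun k => x k + y k).
Proof.
move=> x0 y0 e e_gt0; have e2 : 0 < e / 2 by rewrite divr_gt0.
have [[N xN] [N' yN]] := (x0 _ e2, y0 _ e2).
exists (maxn N N') => k; rewrite geq_max => /andP[/xN xk /yN yk].
by apply: le_lt_trans (ler_normD _ _) _; rewrite [e](splitr e) ltrD.
Qed.

Lemma tends_to_0Z c x : tends_to_0 x -> tends_to_0 (fun k => c * x k).
Proof.
by apply: (@tends_to_0_le `|c| _ _ 0) => // k _; rewrite normrM.
Qed.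

Lemma tends_to_0_norm x : tends_to_0 x -> tends_to_0 (fun k => `|x k|).
Proof. by apply: (@tends_to_0_le 1 _ _ 0) => // k _; rewrite mul1r normr_id. Qed.

Lemma tends_to_0_sum n (x : 'I_n -> nat -> algC) : (forall i, tends_to_0 (x i)) ->
  tends_to_0 (fun k => \sum_(i < n) x i k).
Proof.
elim: n x => [|n IHn] x x0.
  by move=> e e_gt0; exists 0%N => k _; rewrite big_ord0 normr0.
apply: eq_tends_to_0 (tends_to_0D (x0 ord0) (IHn _ (fun i => x0 (lift ord0 i)))).
by move=> k; rewrite big_ord_recl.
Qed.

Lemma bernoulli (h : algC) k : 0 <= h -> 1 + k%:R * h <= (1 + h) ^+ k.
Proof.
move=> h_ge0; elim: k => [|k IHk]; first by rewrite mul0r addr0 expr0.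
rewrite exprS; apply: le_trans (_ : (1 + h) * (1 + k%:R * h) <= _); last first.
  by rewrite ler_wpM2l // addr_ge0.
rewrite -natr1 (_ : _ * (1 + _) = 1 + (k%:R + 1) * h + h * (k%:R * h)); last by ring.
by rewrite lerDl !mulr_ge0.
Qed.

Lemma tends_to_0_exp (q : algC) : 0 < q -> q < 1 -> tends_to_0 (fun k => q ^+ k).
Proof.
(* Bernoulli's inequality for [1 / q = 1 + h] gives [q^k < e] as soon as [k > 1 / (e h)]. *)
move=> q_gt0 q_lt1 e e_gt0; pose h := q^-1 - 1.
have h_gt0 : 0 < h by rewrite subr_gt0 invf_gt1.
have x_ge0 : 0 <= (e * h)^-1 by rewrite invr_ge0 ltW // mulr_gt0.
exists (Num.bound (e * h)^-1) => k lek.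
have ltk : (e * h)^-1 < k%:R.
  by apply: lt_le_trans (archi_boundP x_ge0) _; rewrite ler_nat.
rewrite normrX ger0_norm ?ltW // -[X in X ^+ _]invrK exprVn.
rewrite -[e]invrK ltf_pV2 ?posrE ?exprn_gt0 ?invr_gt0 //.
have -> : q^-1 = 1 + h by rewrite addrC subrK.
apply: lt_le_trans (bernoulli k (ltW h_gt0)); rewrite ltr_wpDl ?ler01 //.
by move: ltk; rewrite invfM -ltr_pdivlMr ?invr_gt0 // invrK.
Qed.

(** * Geometric bounds for triangular linear recursions *)

Definition geo_bounded (mu : algC) x := exists2 C, 0 <= C & forall k, `|x k| <= C * mu ^+ k.

Lemma eq_geo_bounded mu x y : x =1 y -> geo_bounded mu x -> geo_bounded mu y.
Proof. by move=> xy [C C0 xC]; exists C => // k; rewrite -xy. Qed.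

Lemma geo_bounded0 mu : 0 <= mu -> geo_bounded mu (fun=> 0).
Proof. by move=> mu0; exists 0 => // k; rewrite normr0 mul0r. Qed.

Lemma geo_boundedZ mu c x : geo_bounded mu x -> geo_bounded mu (fun k => c * x k).
Proof.
move=> [C C0 xC]; exists (`|c| * C) => [|k]; first by rewrite mulr_ge0.
by rewrite normrM -mulrA ler_wpM2l.
Qed.

Lemma geo_bounded_sum mu n (x : 'I_n -> nat -> algC) : 0 <= mu -> (forall i, geo_bounded mu (x i)) ->
  geo_bounded mu (fun k => \sum_(i < n) x i k).
Proof.
move=> mu0; elim: n x => [|n IHn] x x0.
  by apply: eq_geo_bounded (geo_bounded0 mu0) => k; rewrite big_ord0.
have [C C0 xC] := x0 ord0; have [C' C'0 xC'] := IHn _ (fun i => x0 (lift ord0 i)).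
exists (C + C') => [|k]; first by rewrite addr_ge0.
by rewrite big_ord_recl mulrDl (le_trans (ler_normD _ _)) // lerD.
Qed.

Lemma geo_bounded_rec mu lam x y : 0 <= lam -> lam < mu -> geo_bounded mu y ->
  (forall k, x k.+1 = lam * x k + y k) -> geo_bounded mu x.
Proof.
(* This [C'] dominates [|x 0|] and satisfies [lam C' + C <= mu C'], which closes the induction. *)
move=> lam0 lammu [C C0 yC] xE; pose C' := `|x 0%N| + C / (mu - lam).
have d0 : 0 < mu - lam by rewrite subr_gt0.
have q0 : 0 <= C / (mu - lam) by rewrite divr_ge0 // ltW.
have C'0 : 0 <= C' by rewrite addr_ge0.
exists C' => //; elim=> [|k IHk]; first by rewrite expr0 mulr1 lerDl.
rewrite xE (le_trans (ler_normD _ _)) // normrM (ger0_norm lam0).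
apply: le_trans (lerD (ler_wpM2l lam0 IHk) (yC k)) _.
rewrite exprS !mulrA -mulrDl; apply: ler_wpM2r; first by rewrite ?exprn_ge0 ?(le_trans lam0 (ltW _)).
rewrite -lerBrDl [C' * mu]mulrC -mulrBl mulrDr [_ * (C / _)]mulrC divfK ?gt_eqF //.
by rewrite lerDr mulr_ge0 // ltW.
Qed.

Lemma geo_bounded_lt mu N x : 0 < mu -> mu < N -> geo_bounded mu x -> tends_to_0 (fun k => x k / N ^+ k).
Proof.
move=> mu0 muN [C C0 xC]; have N0 := lt_trans mu0 muN.
apply: (@tends_to_0_le C _ (fun k => (mu / N) ^+ k) 0) => // [k _|].
  have [mu_ge0 N_ge0] := (ltW mu0, ltW N0).
  rewrite normrM [`|(mu / N) ^+ k|]ger0_norm ?exprn_ge0 ?divr_ge0 //.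
  rewrite [`|_^-1|]ger0_norm ?invr_ge0 ?exprn_ge0 // expr_div_n mulrA.
  by rewrite ler_wpM2r // invr_ge0 exprn_ge0.
by apply: tends_to_0_exp; rewrite ?divr_gt0 // ltr_pdivrMr ?mul1r.
Qed.

(* Diagonal entries [a!] with [a < n] stay below [mu], so only the top entry grows like [n!^k]. *)
Lemma fnum_iter_geo_bounded n (mu : algC) (x : nat -> nat -> algC) :
    (1 < n)%N -> (forall a, (a < n)%N -> a`!%:R < mu) ->
    (forall a k, (a <= n)%N -> x a k.+1 = \sum_(b < n.+1) (fnum a b)%:R * x b k) ->
    x n 0%N = 0 ->
  forall a, (a <= n)%N -> geo_bounded mu (x a).
Proof.
move=> n1 mun xE x0; have mu0 : 0 <= mu.
  by apply: le_trans (ltW (mun 0%N _)); rewrite ?ler0n // (ltn_trans _ n1).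
(* Descending induction on [a]: apart from its diagonal term, row [a] involves only rows [b > a],
   and row [n] stays zero. *)
move=> a an; have [m] := ubnP (n - a); elim: m a an => // m IHm a an lem.
have xE' k : x a k.+1 = a`!%:R * x a k +
    \sum_(b < n.+1) (if (a < b)%N then (fnum a b)%:R * x b k else 0).
  rewrite xE // (bigD1 (Ordinal (an : (a < n.+1)%N))) //= fnum_diag; congr (_ + _).
  rewrite [LHS]big_mkcond; apply: eq_bigr => i _; rewrite -val_eqE /=.
  by case: ltngtP => //= ia; rewrite fnum_gt // mul0r.
move: an; rewrite leq_eqVlt => /orP[/eqP an|an].
  apply: eq_geo_bounded (geo_bounded0 mu0); elim=> [|k IHk]; first by rewrite an x0.
  rewrite xE' -IHk mulr0 add0r big1 // => i _.
  by rewrite an ltnNge -ltnS ltn_ord.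
apply: (geo_bounded_rec (ler0n _ _) (mun a an) _ xE').
apply: geo_bounded_sum => // i; case: (ltnP a i) => ab; last exact: geo_bounded0.
by apply: geo_boundedZ; apply: IHm; have := ltn_ord i; lia.
Qed.

(** * Asymptotics of f-vectors and of the coefficients of h-polynomials *)

Lemma fsimp_asymp (T : finType) (D : {set {set T}}) d a :
    is_complex D -> (0 < d)%N -> top D = d.+1 -> (a <= d.+1)%N ->
  tends_to_0 (fun k => (fsimp (baryk D k) a)%:R / (d.+1)`!%:R ^+ k
                       - (fsimp D d.+1)%:R * Fcoef a d).
Proof.
move=> cD d_gt0 topD ad; set N : algC := (d.+1)`!%:R.
(* The subtracted term solves the same recursion and agrees with the f-vector in its top entry, so
   the difference has top entry zero. *)
pose x a k : algC := (fsimp (baryk D k) a)%:R - (fsimp D d.+1)%:R * Fcoef a d * N ^+ k.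
have n_gt0 : (0 < top D)%N by rewrite topD.
have N_ge2 : 2 <= N.
  rewrite ler_nat; by apply: leq_trans (fact_geq d.+1).
(* As factorials are integers, [N - 1/2] separates [N] from every [b!] with [b <= d]. *)
have mu_lt : N - 2^-1 < N by rewrite ltrBlDr ltrDl invr_gt0.
have mu_gt b : (b < d.+1)%N -> b`!%:R < N - 2^-1.
  move=> bd; rewrite ltrBrDr; apply: lt_le_trans (_ : b`!%:R + 1 <= N).
    by rewrite ltrD2l invf_lt1 // ltr1n.
  by rewrite natr1 ler_nat ltn_fact_gt1.
have mu_gt0 : 0 < N - 2^-1 by apply: lt_trans (mu_gt 0%N _).
have : geo_bounded (N - 2^-1) (x a).
  apply: (@fnum_iter_geo_bounded d.+1) => // [b k bd|]; last first.
    by rewrite /x /= Fcoef_top expr0 !mulr1 subrr.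
  rewrite /x fsimp_baryk // topD natr_sum.
  under [RHS]eq_bigr do rewrite mulrBr -natrM.
  rewrite sumrB; congr (_ - _).
  rewrite exprS; set f : algC := (fsimp D _)%:R.
  transitivity (f * N ^+ k * (N * Fcoef b d)); first by ring.
  rewrite Fcoef_eigen // mulr_sumr.
  by apply: eq_bigr => i _; ring.
move/(geo_bounded_lt mu_gt0 mu_lt); apply: eq_tends_to_0 => k.
have Nk : N ^+ k != 0 by rewrite expf_neq0 // gt_eqF // (lt_le_trans _ N_ge2).
by rewrite /x mulrBl mulfK.
Qed.

Section HPolynomial.
Variables (T : finType) (D : {set {set T}}) (d : nat).
Hypotheses (cD : is_complex D) (d_gt0 : (0 < d)%N) (topD : top D = d.+1).

Let n_gt0 : (0 < top D)%N. Proof. by rewrite topD. Qed.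

Lemma hpoly_baryk k : hpoly (baryk D k) =
  \sum_(j < d.+2) (fsimp (baryk D k) j)%:R *: ('X - 1) ^+ (d.+1 - j)%N.
Proof. by rewrite /hpoly top_baryk // topD. Qed.

(** Only the empty face, counted once, contributes in degree [d + 1]. *)
Lemma hpoly_monic k : hpoly (baryk D k) \is monic /\ size (hpoly (baryk D k)) = d.+2.
Proof.
rewrite hpoly_baryk big_ord_recl fsimp0; last by case: (baryk_complex k cD).
rewrite scale1r subn0; set q := \sum_(i < d.+1) _.
have szq : (size q < size (('X - 1 : {poly algC}) ^+ d.+1))%N.
  rewrite size_expXsubC1 ltnS; apply: leq_trans (size_sum _ _ _) _.
  apply/bigmax_leqP => i _; apply: leq_trans (size_scale_leq _ _) _.
  by rewrite size_expXsubC1 lift0 subSS ltnS leq_subr.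
rewrite monicE lead_coefDl // size_polyDl // size_expXsubC1; split=> //.
by rewrite -polyC1; have := monic_exp d.+1 (monicXsubC (1 : algC)); rewrite monicE.
Qed.

Lemma hpoly_coef_asymp i :
  tends_to_0 (fun k => (hpoly (baryk D k))`_i / (d.+1)`!%:R ^+ k
                       - (fsimp D d.+1)%:R * (Hpoly d)`_i).
Proof.
pose c (j : 'I_d.+2) : algC := (('X - 1) ^+ (d.+1 - j)%N)`_i.
have := tends_to_0_sum (fun j : 'I_d.+2 =>
  tends_to_0Z (c j) (fsimp_asymp cD d_gt0 topD (ltn_ord j : (j <= d.+1)%N))).
apply: eq_tends_to_0 => k; rewrite hpoly_baryk Hpoly_sum !coef_sum mulr_suml mulr_sumr -sumrB.
by apply: eq_bigr => j _; rewrite !coefZ /c; ring.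
Qed.

(** Evaluating [Xn_binp] at [-1] shows that the row vector of signs is fixed by [fnum]. *)
Lemma signed_fsimp_baryk k :
  \sum_(j < d.+2) (-1) ^+ j * (fsimp (baryk D k) j)%:R =
  \sum_(j < d.+2) (-1) ^+ j * (fsimp D j)%:R :> algC.
Proof.
elim: k => // k <-.
under eq_bigr do rewrite fsimp_baryk // topD natr_sum mulr_sumr.
rewrite exchange_big; apply: eq_bigr => -[b /= bd] _.
under eq_bigr do rewrite natrM mulrA.
rewrite -mulr_suml; congr (_ * _).
have := congr1 (fun p => p.[-1]) (Xn_binp algC bd).
rewrite hornerXn horner_sum => ->; apply: eq_bigr => -[a /= ad] _.
by rewrite (hornerZ _ (binp _ _)) hornerN1_binp mulrC.
Qed.

Lemma rchiE : (rchi D)%:~R = - \sum_(j < d.+2) (-1) ^+ j * (fsimp D j)%:R :> algC.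
Proof.
have ltm s : s \in D -> (#|s| < d.+2)%N by move=> /ltn_top; rewrite topD.
rewrite /rchi (@sum_card int _ _ (fun b => (-1) ^+ b.+1) d.+2) // rmorph_sum -sumrN /=.
by apply: eq_bigr => j _; rewrite rmorphMn rmorphXn rmorphN1 exprS mulN1r mulr_natr mulNrn.
Qed.

Lemma hpoly_coef0 k : `|(hpoly (baryk D k))`_0| = `|(rchi D)%:~R|.
Proof.
rewrite rchiE -(signed_fsimp_baryk k) hpoly_baryk normrN coef_sum.
rewrite -(normrMsign d.+1 (\sum_(j < _) _)) mulr_sumr; congr `|_|.
apply: eq_bigr => -[j /= jd] _; rewrite coefZ -horner_coef0 -polyC1 horner_exp hornerXsubC sub0r.
rewrite mulrA -[(-1) ^+ (d.+1 - j)]signr_odd oddB // signr_addb !signr_odd. 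
by rewrite mulrACA -expr2 sqrr_sign mul1r mulrC.
Qed.

End HPolynomial.

(** * Vieta bounds for the extreme roots *)

Lemma root_sum_bound (p : {poly algC}) n (r : algC) : p \is monic -> size p = n.+2 ->
  (forall z, root p z -> `|z| <= `|r|) -> `|p`_n| <= n.+1%:R * `|r|.
Proof.
move=> /monicP lp szp rmax; have [s ps] := closed_field_poly_normal p.
move: ps; rewrite lp scale1r => ps.
have szs : size s = n.+1 by move: szp; rewrite ps size_prod_XsubC => -[].
have -> : p`_n = - \sum_(z <- s) z.
  by rewrite ps -coefPn_prod_XsubC ?szs // -size_eq0 szs.
rewrite normrN (le_trans (ler_norm_sum _ _ _)) //.
have : forall z, z \in s -> `|z| <= `|r|.
  by move=> z zs; apply: rmax; rewrite ps root_prod_XsubC.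
rewrite -szs; elim: s {szs ps} => [|z s IHs] sr; first by rewrite big_nil mul0r.
rewrite big_cons /= -natr1 mulrDl mul1r addrC lerD ?IHs ?sr ?mem_head // => y ys.
by rewrite sr // inE ys orbT.
Qed.

(** Up to sign, [p_1] is the sum of the products of all roots but one; each omitted root has modulus
    at least [|r|]. Avoiding division allows zero roots. *)
Lemma root_coef1_bound (p : {poly algC}) n (r : algC) : p \is monic -> size p = n.+1 ->
  (forall z, root p z -> `|r| <= `|z|) -> `|r| * `|p`_1| <= n%:R * `|p`_0|.
Proof.
move=> /monicP lp szp rmin; have [s ps] := closed_field_poly_normal p.
move: ps; rewrite lp scale1r => ps.
have szs : size s = n by move: szp; rewrite ps size_prod_XsubC => -[].
have : forall z, z \in s -> `|r| <= `|z|.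
  by move=> z zs; apply: rmin; rewrite ps root_prod_XsubC.
rewrite ps -szs; elim: s {szs ps} => [|z s IHs] sr.
  by rewrite big_nil -polyC1 !coefC /= normr0 mulr0 mul0r.
have {}IHs := IHs (fun z' ys => sr z' (mem_behead (s := z :: s) ys)).
rewrite big_cons mulrBl !coefB !coefXM !mul_polyC !coefZ /=.
set q := \prod_(j <- s) _ in IHs *.
rewrite sub0r normrN normrM; apply: le_trans (ler_wpM2l (normr_ge0 _) (ler_normB _ _)) _.
rewrite mulrDr normrM -natr1 mulrDl mul1r addrC lerD //.
  by rewrite mulrCA [n in _ <= n]mulrCA ler_wpM2l.
by rewrite ler_wpM2r // sr // mem_head.
Qed.

Lemma tends_to_0_bounded x c : tends_to_0 (fun k => x k - c) ->
  exists N, forall k, (N <= k)%N -> `|x k| <= `|c| + 1.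
Proof.
move=> /(_ 1 ltr01)[N xN]; exists N => k /xN /ltW xk.
by rewrite -[x k](subrK c) (le_trans (ler_normD _ _)) // addrC lerD2l.
Qed.

Lemma tends_to_0_lower x c : 0 < c -> tends_to_0 (fun k => x k - c) ->
  exists N, forall k, (N <= k)%N -> c / 2 <= `|x k|.
Proof.
move=> c_gt0 /(_ (c / 2))[|N xN]; first by rewrite divr_gt0.
exists N => k /xN /ltW xk.
have : `|c| <= `|x k| + `|x k - c|.
  by rewrite [X in _ + X]distrC -{1}[c](subrKC (x k)) ler_normD.
rewrite gtr0_norm // => le; have := le_trans le (lerD (lexx _) xk).
by rewrite -lerBlDr {1}[c](splitr c) addrK.
Qed.

Lemma uniform_threshold n (P : 'I_n -> nat -> Prop) :
  (forall i, exists N, forall k, (N <= k)%N -> P i k) ->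
  exists N, forall k, (N <= k)%N -> forall i, P i k.
Proof.
elim: n P => [|n IHn] P PN; first by exists 0%N => k _ [].
have [[N0 H0] [N1 H1]] := (PN ord0, IHn _ (fun i => PN (lift ord0 i))).
exists (maxn N0 N1) => k; rewrite geq_max => /andP[/H0 P0 /H1 P1] i.
by case: (unliftP ord0 i) => [j|] ->.
Qed.

Lemma norm_sum_le_const n (x : 'I_n -> algC) K : (forall i, `|x i| <= K) ->
  `|\sum_(i < n) x i| <= n%:R * K.
Proof.
move=> xK; rewrite (le_trans (ler_norm_sum _ _ _)) // mulr_natl.
by apply: le_trans (ler_sum _ (fun i _ => xK i)) _; rewrite sumr_const card_ord.
Qed.

(** * Extreme roots of monic polynomials with coefficients [(c i + o(1)) M^k] *)

Section RootAsymptotics.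
Variables (n : nat) (p : nat -> {poly algC}) (M : algC) (c : nat -> algC).
Hypotheses (M_gt1 : 1 < M) (n_gt0 : (0 < n)%N).
Hypothesis pM : forall k, p k \is monic.
Hypothesis szp : forall k, size (p k) = n.+2.
Hypothesis pc : forall i, tends_to_0 (fun k => (p k)`_i / M ^+ k - c i).

Let M_gt0 k : 0 < M ^+ k. Proof. by rewrite exprn_gt0 // (lt_trans ltr01). Qed.

Let invM0 : tends_to_0 (fun k => (M ^+ k)^-1).
Proof.
apply: eq_tends_to_0 (tends_to_0_exp (q := M^-1) _ _) => [k||].
- by rewrite exprVn.
- by rewrite invr_gt0 (lt_trans ltr01).
- by rewrite invf_lt1 // (lt_trans ltr01).
Qed.

Lemma coef_bounded : exists2 B, 0 < B &
  exists N, forall k, (N <= k)%N -> forall i : 'I_n.+2, `|(p k)`_i| <= B * M ^+ k.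
Proof.
exists (\sum_(i < n.+2) (`|c i| + 1)).
  by rewrite big_ord_recl ltr_pwDl ?ltr_wpDl // sumr_ge0 // => i _; rewrite addr_ge0.
apply: (uniform_threshold (P := fun i k => `|(p k)`_i| <= _ * M ^+ k)) => i.
have [N pN] := tends_to_0_bounded (pc i); exists N => k /pN.
rewrite normrM normfV [`|M ^+ k|]gtr0_norm // ler_pdivrMr // => /le_trans; apply.
apply: ler_wpM2r; rewrite ?(ltW (M_gt0 k)) // (bigD1 i) //= lerDl sumr_ge0 // => j _.
by rewrite addr_ge0.
Qed.

Lemma coef_lower i : 0 < c i ->
  exists N, forall k, (N <= k)%N -> c i / 2 * M ^+ k <= `|(p k)`_i|.
Proof.
move=> ci; have [N pN] := tends_to_0_lower ci (pc i); exists N => k /pN.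
by rewrite normrM normfV [`|M ^+ k|]gtr0_norm // ler_pdivlMr.
Qed.

(* The top two coefficients dominate: [r = - p_n + O(1)] for the root [r] of maximal modulus. *)
Lemma max_root_asym (r : nat -> algC) : 0 < c n ->
  (forall k, root (p k) (r k) /\ forall z, root (p k) z -> `|z| <= `|r k|) ->
  asym r (fun k => - c n * M ^+ k).
Proof.
move=> cn_gt0 rmax; set C := c n.
have [B B_gt0 [N1 HB]] := coef_bounded.
have [N2 HC] := coef_lower cn_gt0.
(* From [|p_n| >= (C / 2) M^k] and [root_sum_bound], [|R| >= del M^k]; once [M^-k < del], this gives
   [|R| >= 1]. *)
pose del := C / 2 / n.+1%:R; have del_gt0 : 0 < del by rewrite !divr_gt0 ?ltr0n.
have [N3 HM] := invM0 del_gt0.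
pose y k := (M ^+ k)^-1 * (n%:R * B / del) + `|(p k)`_n / M ^+ k - C|.
have y0 : tends_to_0 y.
  apply: tends_to_0D; last exact/tends_to_0_norm/pc.
  by apply: eq_tends_to_0 (tends_to_0Z (n%:R * B / del) invM0) => k; rewrite mulrC.
suff : tends_to_0 (fun k => r k / (- C * M ^+ k) - 1) by [].
apply: (@tends_to_0_le C^-1 _ y (maxn N1 (maxn N2 N3))) => // [|k]; first by rewrite invr_ge0 ltW.
rewrite !geq_max => /and3P[/HB{}HB /HC{}HC /HM{}HM].
have [rk rkmax] := rmax k; set R := r k in rk rkmax *.
have Mk := M_gt0 k; have MkE : M ^+ k != 0 by rewrite gt_eqF.
have CE : C != 0 by rewrite gt_eqF.
have R_ge : del * M ^+ k <= `|R|.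
  have := le_trans HC (root_sum_bound (pM k) (szp k) rkmax).
  by move=> le; rewrite /del mulrAC ler_pdivrMr ?ltr0n // [_ * n.+1%:R]mulrC.
have R_ge1 : 1 <= `|R|.
  apply: le_trans R_ge; move: HM; rewrite normfV gtr0_norm // => /ltW.
  by rewrite -(ler_pM2r Mk) mulVf.
have R_gt0 : 0 < `|R| by apply: lt_le_trans R_ge1.
have RE : (R + (p k)`_n) * R ^+ n = - \sum_(i < n) (p k)`_i * R ^+ i.
  apply/eqP; rewrite -addr_eq0; move: rk; rewrite /root horner_coef szp.
  rewrite !big_ord_recr /=.
  have := pM k; rewrite monicE lead_coefE szp /= => /eqP->.
  by move/eqP=> E; rewrite -[X in _ == X]E; apply/eqP; rewrite exprS; ring.
(* As [|R| >= 1], each lower term is at most [B M^k |R|^(n-1)]; dividing by [|R|^n] and using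
   [|R| >= del M^k] removes the factor [M^k]. *)
have RnB : `|R + (p k)`_n| <= n%:R * B / del.
  have Rn : 0 < `|R| ^+ n.-1 by rewrite exprn_gt0.
  rewrite ler_pdivlMr // -(ler_pM2r (mulr_gt0 Mk Rn)).
  apply: (@le_trans _ _ (`|(R + (p k)`_n) * R ^+ n|)).
    rewrite normrM normrX -[n in _ <= _ * _ ^+ n](prednK n_gt0) exprS -!mulrA.
    rewrite ler_wpM2l // !mulrA ler_wpM2r // ltW //.
  rewrite RE normrN -!mulrA; apply: norm_sum_le_const => i.
  rewrite normrM normrX mulrA; apply: ler_pM; rewrite ?exprn_ge0 //.
    by have := HB (widen_ord (leqW (leqnSn n)) i).
  by rewrite ler_weXn2l // -ltnS prednK.
have -> : R / (- C * M ^+ k) - 1 = - C^-1 * ((R + (p k)`_n) / M ^+ k - ((p k)`_n / M ^+ k - C)).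
  by field; rewrite CE MkE.
rewrite normrM normrN [`|C^-1|]gtr0_norm ?invr_gt0 // ler_wpM2l ?invr_ge0 ?(ltW cn_gt0) //.
rewrite (le_trans (ler_normB _ _)) //.
rewrite [`|y k|]ger0_norm ?addr_ge0 ?mulr_ge0 ?invr_ge0 ?(ltW Mk) ?(ltW B_gt0) ?(ltW del_gt0) //.
rewrite lerD // normrM normfV [`|M ^+ k|]gtr0_norm // mulrC ler_wpM2l // invr_ge0 ltW //.
Qed.

(* Near [0] the constant and linear terms dominate: [p_0 + c_1 M^k r = o(1)]. *)
Lemma min_root_asym (r : nat -> algC) (A : algC) : 0 < c 1%N -> 0 < A ->
  (forall k, `|(p k)`_0| = A) ->
  (forall k, root (p k) (r k) /\ forall z, root (p k) z -> `|r k| <= `|z|) ->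
  tends_to_0 (fun k => A / (c 1%N * `|r k| * M ^+ k) - 1).
Proof.
move=> c1_gt0 A_gt0 pA rmin; set C := c 1%N.
have [B B_gt0 [N1 HB]] := coef_bounded.
have [N2 HC] := coef_lower c1_gt0.
have C2_gt0 : 0 < C / 2 by rewrite divr_gt0.
(* By [root_coef1_bound] and [|p_1| >= (C / 2) M^k], [L] bounds [M^k |R|]. *)
pose L := n.+1%:R * A / (C / 2); have L_gt0 : 0 < L by rewrite divr_gt0 // mulr_gt0 ?ltr0n.
have [N3 HM] : exists N, forall k, (N <= k)%N -> `|(M ^+ k)^-1| < L^-1 by apply: invM0; rewrite invr_gt0.
pose y k := (M ^+ k)^-1 * (n%:R * (B * L ^+ 2)) + L * `|(p k)`_1 / M ^+ k - C|.
have y0 : tends_to_0 y.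
  apply: tends_to_0D; last exact/tends_to_0Z/tends_to_0_norm/pc.
  by apply: eq_tends_to_0 (tends_to_0Z (n%:R * (B * L ^+ 2)) invM0) => k; rewrite mulrC.
(* This keeps [C M^k |R|] above [A / 2], so that dividing by it is harmless. *)
have [N4 Hy] : exists N, forall k, (N <= k)%N -> `|y k| < A / 2 by apply: y0; rewrite divr_gt0.
apply: (@tends_to_0_le (A / 2)^-1 _ y (maxn (maxn N1 N2) (maxn N3 N4))) => // [|k].
  by rewrite invr_ge0 ltW // divr_gt0.
rewrite !geq_max => /andP[/andP[/HB{}HB /HC{}HC] /andP[/HM{}HM /Hy{}Hy]].
have [rk rkmin] := rmin k; set R := r k in rk rkmin *.
have Mk := M_gt0 k; have MkE : M ^+ k != 0 by rewrite gt_eqF.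
have RM_le : M ^+ k * `|R| <= L.
  have le := root_coef1_bound (pM k) (szp k) rkmin.
  rewrite ler_pdivlMr ?divr_gt0 // mulrC mulrA -(pA k); apply: le_trans le.
  by rewrite [X in _ <= X]mulrC ler_wpM2r.
have R_le1 : `|R| <= 1.
  rewrite -(ler_pM2l Mk) mulr1; apply: le_trans RM_le _.
  move: HM; rewrite normfV gtr0_norm // => /ltW.
  by rewrite lef_pV2.
have RE : (p k)`_0 + (p k)`_1 * R = - \sum_(i < n) (p k)`_i.+2 * R ^+ i.+2.
  apply/eqP; rewrite -addr_eq0; move: rk; rewrite /root horner_coef szp.
  rewrite !big_ord_recl /= expr0 expr1 mulr1 addrA.
  by [].
(* As [|R| <= 1], each term of degree at least two is at most [B M^k |R|^2 = M^-k B (M^k |R|)^2]. *)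
have sumB : `|(p k)`_0 + (p k)`_1 * R| <= (M ^+ k)^-1 * (n%:R * (B * L ^+ 2)).
  rewrite RE normrN mulrCA; apply: norm_sum_le_const => i.
  rewrite normrM normrX; apply: (@le_trans _ _ (B * M ^+ k * `|R| ^+ 2)).
    apply: ler_pM; rewrite ?exprn_ge0 //; first by have := HB (lift ord0 (lift ord0 i)).
    by rewrite ler_wiXn2l.
  have -> : B * M ^+ k * `|R| ^+ 2 = (M ^+ k)^-1 * (B * (M ^+ k * `|R|) ^+ 2) by field.
  rewrite ler_pM2l ?invr_gt0 // ler_pM2l // lerXn2r // nnegrE; last exact: ltW.
  by rewrite mulr_ge0 // ltW.
have diff : `|A - C * (M ^+ k * `|R|)| <= y k.
  have -> : C * (M ^+ k * `|R|) = `|C * M ^+ k * R|.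
    by rewrite !normrM [`|C|]gtr0_norm // [`|M ^+ k|]gtr0_norm // mulrA.
  (* Only the modulus of [p_0] is known, hence the reverse triangle inequality between [p_0] and
     [- C M^k R]. *)
  rewrite -(pA k) -[`|C * _ * R|]normrN; apply: le_trans (ler_dist_dist _ _) _.
  have -> : (p k)`_0 - - (C * M ^+ k * R) =
      ((p k)`_0 + (p k)`_1 * R) - M ^+ k * R * ((p k)`_1 / M ^+ k - C) by field.
  apply: le_trans (ler_normB _ _) (lerD sumB _).
  by rewrite normrM ler_wpM2r // normrM [`|M ^+ k|]gtr0_norm.
have y_ge0 : 0 <= y k by apply: le_trans diff.
rewrite [`|y k|]ger0_norm // in Hy *.
set z := C * (M ^+ k * `|R|) in diff *.
have z_ge0 : 0 <= z by rewrite !mulr_ge0 // ltW.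
have ge2 : A / 2 <= z.
  have : A - z <= A / 2.
    apply: le_trans (real_ler_norm _) (le_trans diff (ltW Hy)).
    by rewrite rpredB // ger0_real // ltW.
  by rewrite lerBlDr -lerBlDl {1}[A]splitr addrK.
have z_gt0 : 0 < z by apply: lt_le_trans ge2; rewrite divr_gt0.
have -> : C * `|R| * M ^+ k = z by rewrite /z; ring.
have -> : A / z - 1 = z^-1 * (A - z) by field; rewrite gt_eqF.
rewrite normrM [`|z^-1|]gtr0_norm ?invr_gt0 //; apply: ler_pM => //.
  by rewrite invr_ge0.
by rewrite lef_pV2 ?posrE ?divr_gt0.
Qed.

End RootAsymptotics.

Theorem theorem1p2 (T : finType) (D : {set {set T}}) :
  is_complex D -> (1 <= dimc D)%N ->
  forall rinf r0 : nat -> algC,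
  (forall k : nat, root (hpoly (baryk D k)) (rinf k) /\
     (forall z : algC, root (hpoly (baryk D k)) z -> `|z| <= `|rinf k|)) ->
  (forall k : nat, root (hpoly (baryk D k)) (r0 k) /\
     (forall z : algC, root (hpoly (baryk D k)) z -> `|r0 k| <= `|z|)) ->
  asym rinf (fun k => - Hcoef 1 (dimc D) * (fsimp D (dimc D).+1)%:R
                        * (factorial (dimc D).+1)%:R ^+ k)
  /\
  exists e : nat -> algC, tends_to_0 e /\
    forall k : nat,
      `|(rchi D)%:~R : algC| =
        Hcoef 1 (dimc D) * (fsimp D (dimc D).+1)%:R * `|r0 k|
          * (factorial (dimc D).+1)%:R ^+ k * (1 + e k).
Proof.
move=> cD d_gt0 rinf r0 rinfP r0P; set d := dimc D in d_gt0 *.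
have topD : top D = d.+1.
  by move: d_gt0; rewrite /d /dimc; case: (top D).
have M_gt1 : 1 < (d.+1)`!%:R :> algC.
  by rewrite ltr1n; apply: leq_trans (fact_geq d.+1).
set f : algC := (fsimp D d.+1)%:R.
have f_gt0 : 0 < f by rewrite ltr0n -topD fsimp_top //; case: cD.
have H_gt0 : 0 < Hcoef 1 d by rewrite Hcoef1 // Fcoef1_gt0.
have HdE : (Hpoly d)`_d = Hcoef 1 d by rewrite /Hcoef subn1.
have H1E : (Hpoly d)`_1 = Hcoef 1 d by rewrite Hpoly_coef1 // Hcoef1.
pose c i : algC := f * (Hpoly d)`_i.
have cd_gt0 : 0 < c d by rewrite /c HdE mulr_gt0.
have c1_gt0 : 0 < c 1%N by rewrite /c H1E mulr_gt0.
have pM k := (hpoly_monic cD topD k).1.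
have szp k := (hpoly_monic cD topD k).2.
have pc i : tends_to_0 (fun k => (hpoly (baryk D k))`_i / (d.+1)`!%:R ^+ k - c i).
  exact: hpoly_coef_asymp.
have p0 k := hpoly_coef0 cD topD k.
split.
  apply: eq_tends_to_0 (max_root_asym M_gt1 d_gt0 pM szp pc cd_gt0 rinfP) => k.
  by rewrite /c HdE -mulrN [f * _]mulrC.
have root0 k : root (hpoly (baryk D k)) 0 = ((rchi D)%:~R == 0 :> algC).
  by rewrite /root horner_coef0 -normr_eq0 p0 normr_eq0.
(* If the characteristic vanishes, [0] is a root, so the minimal root is [0] and both sides vanish
   for any [e]. Otherwise [r0 k] is nonzero and the identity can be solved for [e k]. *)
have [chi0 | chi_neq0] := eqVneq ((rchi D)%:~R : algC) 0.
  exists (fun=> 0); split=> [eps eps_gt0 | k]; first by exists 0%N => k _; rewrite normr0.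
  have /(r0P k).2 : root (hpoly (baryk D k)) 0 by rewrite root0 chi0.
  by rewrite normr0 normr_le0 => /eqP->; rewrite chi0 normr0 mulr0 !mul0r.
have chi_gt0 : 0 < `|(rchi D)%:~R : algC| by rewrite normr_gt0.
exists (fun k => `|(rchi D)%:~R| / (c 1%N * `|r0 k| * (d.+1)`!%:R ^+ k) - 1); split.
  exact: (min_root_asym M_gt1 pM szp pc c1_gt0 chi_gt0 p0 r0P).
move=> k; rewrite addrC subrK /c H1E [f * _]mulrC [RHS]mulrC divfK //.
have r0_neq0 : r0 k != 0.
  by apply: contra_neq chi_neq0 => r00; apply/eqP; rewrite -(root0 k) -r00; case: (r0P k).
by rewrite !mulf_neq0 ?normr_eq0 ?expf_neq0 // gt_eqF // (lt_trans ltr01).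
Qed.
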